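(* Consider a fixed-base serial chain of $N$ rigid bodies with single-DoF joints, as described in the context, in the absence of gravity. For each $i=1,\ldots,N$ let $\mathbf{V}_i$ be any matrix with $\mathrm{Range}(\mathbf{V}_i)=\mathcal{V}_i$, and for $i=0,\ldots,N$ let $\mathbf{C}_i$ be any matrix with $\mathrm{Range}(\mathbf{C}_i^\top)=\mathcal{K}_i$ (with $\mathbf{C}_0=\mathbf{0}_{1\times10}$). For $i=1,\ldots,N$ define $$\mathcal{T}_i=\Big\{\delta\boldsymbol{\pi}\in\mathbb{R}^{10N}:\ \delta\mathbf{I}_{i-1}=-\big({}^{J_i}\mathbf{X}_{i-1}\big)^\top\delta\mathbf{I}_i\,{}^{J_i}\mathbf{X}_{i-1}\ (\text{if } i\ge2),\ \ \mathbf{V}_i^\top\delta\mathbf{I}_i\boldsymbol{\Phi}_i=\mathbf{0},\ \ \mathbf{C}_{i-1}\Big[\big({}^{J_i}\mathbf{X}_{i-1}\big)^\top\delta\mathbf{I}_i^{(k)}\,{}^{J_i}\mathbf{X}_{i-1}\Big]^{\vee}=\mathbf{0}\ \ \forall k=1,\ldots,10,\ \ \delta\mathbf{I}_j=\mathbf{0}\text{ for } j\notin\{i,i-1\}\Big\},$$ where $\delta\mathbf{I}_j=[\delta\boldsymbol\pi_j]^\wedge$, $\delta\mathbf{I}_i^{(0)}=\delta\mathbf{I}_i$ and $\delta\mathbf{I}_i^{(k+1)}=(\boldsymbol{\Phi}_i\times)^\top\delta\mathbf{I}_i^{(k)}+\delta\mathbf{I}_i^{(k)}(\boldsymbol{\Phi}_i\times)$.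 (For $i=1$ the transfer condition refers to the fixed ground, body $0$, which carries no parameters in $\delta\boldsymbol\pi$, and is therefore omitted.) Then $$\mathcal{N}=\bigoplus_{i=1}^{N}\mathcal{T}_i.$$
   Context: Spatial notation. For $\mathbf{x}\in\mathbb{R}^3$, $\mathbf{S}(\mathbf{x})$ is the skew-symmetric matrix with $\mathbf{S}(\mathbf{x})\mathbf{y}=\mathbf{x}\times\mathbf{y}$. For $\mathbf{v}=[\boldsymbol{\omega};\mathbf{u}]\in\mathbb{R}^6$, $(\mathbf{v}\times)=\begin{bmatrix}\mathbf{S}(\boldsymbol{\omega})&\mathbf{0}\\ \mathbf{S}(\mathbf{u})&\mathbf{S}(\boldsymbol{\omega})\end{bmatrix}$. A spatial transform is a matrix $\begin{bmatrix}\mathbf{R}&\mathbf{0}\\-\mathbf{R}\mathbf{S}(\mathbf{p})&\mathbf{R}\end{bmatrix}$ with $\mathbf{R}\in SO(3)$, $\mathbf{p}\in\mathbb{R}^3$. Inertial parameters $\boldsymbol{\pi}=[m,h_x,h_y,h_z,I_{xx},I_{xy},I_{xz},I_{yy},I_{yz},I_{zz}]^\top\in\mathbb{R}^{10}$; the linear map $[\boldsymbol{\pi}]^{\wedge}=\begin{bmatrix}\bar{\mathbf{I}}&\mathbf{S}(\mathbf{h})\\ \mathbf{S}(\mathbf{h})^{\top}&m\mathbf{1}_3\end{bmatrix}$ with $\mathbf{h}=[h_x,h_y,h_z]^\top$ and $\bar{\mathbf{I}}$ the symmetric $3\times3$ matrix with entries $I_{xx},I_{xy},\ldots$; $[\cdot]^{\vee}$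 is its inverse on the 10-dimensional space of such matrices (this space is closed under $\mathbf M\mapsto \mathbf X^\top\mathbf M\mathbf X$ for spatial transforms $\mathbf X$ and under $\mathbf M\mapsto(\boldsymbol\Phi\times)^\top\mathbf M+\mathbf M(\boldsymbol\Phi\times)$). Fixed-base chain. Body $0$ is the fixed ground with $\mathbf{v}_0=\mathbf{0}$. For $i=1,\ldots,N$, joint $i$ has coordinate $q_i\in\mathbb{R}$ and connects body $i-1$ to body $i$ with $\mathbf{v}_i={}^{i}\mathbf{X}_{i-1}(q_i)\mathbf{v}_{i-1}+\boldsymbol{\Phi}_i\dot q_i$, where $\boldsymbol{\Phi}_i\in\mathbb{R}^6$ is fixed, ${}^{i}\mathbf{X}_{i-1}(q_i)={}^{i}\mathbf{X}_{J_i}(q_i)\,{}^{J_i}\mathbf{X}_{i-1}$, ${}^{J_i}\mathbf{X}_{i-1}$ is a constant spatial transform, and ${}^{i}\mathbf{X}_{J_i}(q_i)$ is a spatial transform with ${}^{i}\mathbf{X}_{J_i}(0)=\mathbf{1}_6$ and $\frac{d}{dq_i}{}^{i}\mathbf{X}_{J_i}(q_i)=-(\boldsymbol{\Phi}_i\times){}^{i}\mathbf{X}_{J_i}(q_i)$. Write $\mathbf q=(q_1,\dots,q_N)$, $\boldsymbol{\pi}=[\boldsymbol{\pi}_1^\top,\ldots,\boldsymbol{\pi}_N^\top]^\top\in\mathbb{R}^{10N}$. The attainable velocity span of body $i$ is $\mathcal{V}_i=\mathrm{span}\{\mathbf{v}_i(\mathbf{q},\dot{\mathbf{q}}):\mathbf{q},\dot{\mathbf{q}}\in\mathbb{R}^N\}\subseteq\mathbb{R}^6$.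 Let $\mathbf{k}:\mathbb{R}^6\to\mathbb{R}^{10}$ be the function with $\mathbf{v}^\top[\boldsymbol{\pi}]^\wedge\mathbf{v}=\mathbf{k}(\mathbf{v})^\top\boldsymbol{\pi}$ for all $\mathbf v,\boldsymbol\pi$; the kinetic energy descriptor space is $\mathcal{K}_i=\mathrm{span}\{\mathbf{k}(\mathbf{v}_i(\mathbf{q},\dot{\mathbf{q}})):\mathbf{q},\dot{\mathbf{q}}\in\mathbb{R}^N\}\subseteq\mathbb{R}^{10}$, with $\mathcal K_0=\{\mathbf 0\}$. The parameter nullspace is $\mathcal{N}=\{\delta\boldsymbol{\pi}\in\mathbb{R}^{10N}:\sum_{j=1}^N\mathbf{v}_j^\top[\delta\boldsymbol{\pi}_j]^\wedge\mathbf{v}_j=0\ \forall\mathbf{q},\dot{\mathbf{q}}\}$, i.e. the parameter changes that leave the kinetic energy, and hence the gravity-free dynamics (regressor output $\mathbf{Y}(\mathbf q,\dot{\mathbf q},\ddot{\mathbf q})\delta\boldsymbol\pi$), unchanged. *)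

(* Defs.v *)
From HB Require Import structures.
From Stdlib Require Import Reals ClassicalEpsilon FunctionalExtensionality.
From mathcomp Require Import all_boot all_order all_algebra.

Set Implicit Arguments.
Unset Strict Implicit.
Unset Printing Implicit Defensive.

Definition Req_bool (x y : R) : bool := if Req_EM_T x y then true else false.

Lemma Req_boolP : Equality.axiom Req_bool.
Proof. by move=> x y; rewrite /Req_bool; case: Req_EM_T => h; constructor. Qed.

HB.instance Definition _ := hasDecEq.Build R Req_boolP.

Definition R_find (P : pred R) (n : nat) : option R :=
  match excluded_middle_informative (exists x, P x) with
  | left h => Some (proj1_sig (constructive_indefinite_description _ h))
  | right _ => None
  end.

Lemma R_find_correct P n x : R_find P n = Some x -> P x.
Proof.
rewrite /R_find; case: excluded_middle_informative => // h [<-].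
exact: proj2_sig (constructive_indefinite_description _ h).
Qed.

Lemma R_find_complete (P : pred R) : (exists x, P x) -> exists n, R_find P n.
Proof. by move=> h; exists 0%N; rewrite /R_find; case: excluded_middle_informative. Qed.

Lemma R_find_ext (P Q : pred R) : P =1 Q -> R_find P =1 R_find Q.
Proof. by move=> /functional_extensionality ->. Qed.

HB.instance Definition _ := hasChoice.Build R R_find_correct R_find_complete R_find_ext.

Lemma R_addA : associative Rplus. Proof. by move=> *; rewrite Rplus_assoc. Qed.
Lemma R_addC : commutative Rplus. Proof. exact: Rplus_comm. Qed.
Lemma R_add0 : left_id R0 Rplus. Proof. exact: Rplus_0_l. Qed.
Lemma R_addN : left_inverse R0 Ropp Rplus. Proof. exact: Rplus_opp_l. Qed.

HB.instance Definition _ := GRing.isZmodule.Build R R_addA R_addC R_add0 R_addN.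

Lemma R_mulA : associative Rmult. Proof. by move=> *; rewrite Rmult_assoc. Qed.
Lemma R_mulC : commutative Rmult. Proof. exact: Rmult_comm. Qed.
Lemma R_mul1 : left_id R1 Rmult. Proof. exact: Rmult_1_l. Qed.
Lemma R_mulDl : left_distributive Rmult Rplus. Proof. exact: Rmult_plus_distr_r. Qed.
Lemma R_one_neq0 : R1 != R0 :> R.
Proof. by apply/eqP; exact: R1_neq_R0. Qed.

HB.instance Definition _ :=
  GRing.Zmodule_isComNzRing.Build R R_mulA R_mulC R_mul1 R_mulDl R_one_neq0.

Definition R_inv (x : R) : R := if x == 0%R then 0%R else Rinv x.

Lemma R_mulVf (x : R) : x != 0%R -> (R_inv x * x)%R = 1%R.
Proof.
move=> hx; rewrite /R_inv (negbTE hx).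
have hx' : x <> R0 by apply/eqP.
exact: (Rinv_l x hx').
Qed.

Lemma R_inv0 : R_inv 0%R = 0%R.
Proof. by rewrite /R_inv eqxx. Qed.

HB.instance Definition _ := GRing.ComNzRing_isField.Build R R_mulVf R_inv0.

Local Open Scope ring_scope.

Definition comp n (x : 'cV[R]_n.+1) (k : nat) : R := x (inord k) 0.

(* S(x) with S(x) y = x \times y, x = (x_0, x_1, x_2) *)
Definition skew (x : 'cV[R]_3) : 'M[R]_3 :=
  \matrix_(i < 3, j < 3)
    match nat_of_ord i, nat_of_ord j with
    | 0, 1 => - comp x 2 | 0, 2 => comp x 1
    | 1, 0 => comp x 2   | 1, 2 => - comp x 0
    | 2, 0 => - comp x 1 | 2, 1 => comp x 0
    | _, _ => 0
    end.

Definition ang (v : 'cV[R]_6) : 'cV[R]_3 := @usubmx R 3 3 1 v.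
Definition lin (v : 'cV[R]_6) : 'cV[R]_3 := @dsubmx R 3 3 1 v.

Definition cross6 (v : 'cV[R]_6) : 'M[R]_6 :=
  @block_mx R 3 3 3 3 (skew (ang v)) 0 (skew (lin v)) (skew (ang v)).

Definition SO3 (Rm : 'M[R]_3) : Prop := Rm^T *m Rm = 1%:M /\ \det Rm = 1.

Definition spatial_transform (X : 'M[R]_6) : Prop :=
  exists (Rm : 'M[R]_3) (p : 'cV[R]_3),
    SO3 Rm /\ X = @block_mx R 3 3 3 3 Rm 0 (- (Rm *m skew p)) Rm.

(* inertial parameters pi = [m, hx, hy, hz, Ixx, Ixy, Ixz, Iyy, Iyz, Izz] *)
Definition pmass (pi : 'cV[R]_10) : R := comp pi 0.
Definition pfirst (pi : 'cV[R]_10) : 'cV[R]_3 := \col_(k < 3) comp pi k.+1.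
Definition inertia_index (i j : nat) : nat :=
  match i, j with
  | 0, 0 => 4 | 0, 1 | 1, 0 => 5 | 0, 2 | 2, 0 => 6
  | 1, 1 => 7 | 1, 2 | 2, 1 => 8 | _, _ => 9
  end%N.
Definition pinertia (pi : 'cV[R]_10) : 'M[R]_3 :=
  \matrix_(i < 3, j < 3) comp pi (inertia_index i j).

Definition hat (pi : 'cV[R]_10) : 'M[R]_6 :=
  @block_mx R 3 3 3 3 (pinertia pi) (skew (pfirst pi))
                      (skew (pfirst pi))^T ((pmass pi)%:M).

(* [.]^vee : reads the 10 parameters off a matrix of the form [pi]^wedge;
   on that 10-dimensional space it is the inverse of hat (vee (hat pi) = pi) *)
Definition ent (M : 'M[R]_6) (a b : nat) : R := M (inord a) (inord b).
Definition vee (M : 'M[R]_6) : 'cV[R]_10 :=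
  \col_(k < 10)
    match nat_of_ord k with
    | 0 => ent M 3 3 | 1 => ent M 2 4 | 2 => ent M 0 5 | 3 => ent M 1 3
    | 4 => ent M 0 0 | 5 => ent M 0 1 | 6 => ent M 0 2 | 7 => ent M 1 1
    | 8 => ent M 1 2 | _ => ent M 2 2
    end.

Definition qform (M : 'M[R]_6) (v : 'cV[R]_6) : R := (v^T *m M *m v) 0 0.

(* k(v): the unique vector with v^T [pi]^ v = k(v)^T pi for all pi
   (its j-th entry is v^T [e_j]^ v, by linearity of hat) *)
Definition kvec (v : 'cV[R]_6) : 'cV[R]_10 :=
  \col_(j < 10) qform (hat (delta_mx j 0)) v.

Definition in_span n (S : 'cV[R]_n -> Prop) (x : 'cV[R]_n) : Prop :=
  exists (m : nat) (c : 'I_m -> R) (s : 'I_m -> 'cV[R]_n),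
    (forall k, S (s k)) /\ x = \sum_(k < m) c k *: s k.

Definition in_range n m (A : 'M[R]_(n, m)) (x : 'cV[R]_n) : Prop :=
  exists y : 'cV[R]_m, x = A *m y.

(* Joint i (1 <= i <= N): XJ i q = ^i X_{J_i}(q), XJc i = ^{J_i} X_{i-1},
   Phi i = Phi_i. *)
Definition joint_model (N : nat) (XJ : nat -> R -> 'M[R]_6)
    (XJc : nat -> 'M[R]_6) (Phi : nat -> 'cV[R]_6) : Prop :=
  forall i, (1 <= i <= N)%N ->
    [/\ spatial_transform (XJc i),
        (forall q, spatial_transform (XJ i q)),
        XJ i 0 = 1%:M
      & (forall (q : R) (a b : 'I_6),
           derivable_pt_lim (fun t => XJ i t a b) q
                            ((- (cross6 (Phi i) *m XJ i q)) a b))].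

Fixpoint vel (XJ : nat -> R -> 'M[R]_6) (XJc : nat -> 'M[R]_6)
    (Phi : nat -> 'cV[R]_6) (q qd : nat -> R) (i : nat) : 'cV[R]_6 :=
  match i with
  | 0 => 0
  | j.+1 => XJ j.+1 (q j.+1) *m XJc j.+1 *m vel XJ XJc Phi q qd j
            + qd j.+1 *: Phi j.+1
  end.

Definition Vspace XJ XJc Phi (i : nat) : 'cV[R]_6 -> Prop :=
  in_span (fun v => exists q qd, v = vel XJ XJc Phi q qd i).
Definition Kspace XJ XJc Phi (i : nat) : 'cV[R]_10 -> Prop :=
  in_span (fun w => exists q qd, w = kvec (vel XJ XJc Phi q qd i)).

(* parameter vectors delta pi in R^{10N}: dp j is the block of body j,
   j = 1..N; the ground (j = 0) and j > N carry no parameters *)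
Definition params (N : nat) (dp : nat -> 'cV[R]_10) : Prop :=
  forall j, ((j == 0) || (N < j))%N -> dp j = 0.

Definition nullspace N XJ XJc Phi (dp : nat -> 'cV[R]_10) : Prop :=
  params N dp /\
  forall q qd : nat -> R,
    \sum_(1 <= j < N.+1) qform (hat (dp j)) (vel XJ XJc Phi q qd j) = 0.

Definition dI_iter (Phi : 'cV[R]_6) (M : 'M[R]_6) (k : nat) : 'M[R]_6 :=
  iter k (fun M => (cross6 Phi)^T *m M + M *m cross6 Phi) M.

Definition Tspace N (XJc : nat -> 'M[R]_6) (Phi : nat -> 'cV[R]_6)
    (wV : nat -> nat) (V : forall i, 'M[R]_(6, wV i))
    (rC : nat -> nat) (C : forall i, 'M[R]_(rC i, 10))
    (i : nat) (dp : nat -> 'cV[R]_10) : Prop :=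
  [/\ params N dp,
      (2 <= i)%N -> hat (dp i.-1) = - ((XJc i)^T *m hat (dp i) *m XJc i),
      (V i)^T *m hat (dp i) *m Phi i = 0,
      (forall k, (1 <= k <= 10)%N ->
         C i.-1 *m vee ((XJc i)^T *m dI_iter (Phi i) (hat (dp i)) k *m XJc i) = 0)
    & (forall j, j != i -> j != i.-1 -> dp j = 0)].

Definition direct_sum (N : nat) (A : (nat -> 'cV[R]_10) -> Prop)
    (B : nat -> (nat -> 'cV[R]_10) -> Prop) : Prop :=
  (forall x, A x <->
     exists t : nat -> nat -> 'cV[R]_10,
       (forall i, (1 <= i <= N)%N -> B i (t i)) /\
       (forall j, x j = \sum_(1 <= i < N.+1) t i j)) /\
  (forall t : nat -> nat -> 'cV[R]_10,
     (forall i, (1 <= i <= N)%N -> B i (t i)) ->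
     (forall j, \sum_(1 <= i < N.+1) t i j = 0) ->
     forall i, (1 <= i <= N)%N -> forall j, t i j = 0).

(* Main.v *)
(** At a fixed posture the energy of body [i] is a quadratic polynomial in the
    joint rate, and its rate-dependent part vanishes iff [V_i^T dI_i Phi_i = 0].
    What is left is [u^T X(q)^T dI_i X(q) u], with [u] the velocity of body [i-1]
    seen in the joint frame; its [k]-th [q]-derivative is, up to sign, the same
    form with [dI_i^(k)] in place of [dI_i]. On the 10-dimensional space of
    inertia matrices, Cayley-Hamilton makes the first ten derivatives solve a
    homogeneous linear ODE, so they vanish at [q = 0] iff the form does not depend
    on [q]. Hence the conditions defining [T_i] say exactly that the energy of
    [dI_i] on body [i] equals that of [X^T dI_i X] on body [i-1]. Peeling off the
    last body of the chain then gives both the decomposition and its uniqueness. *)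

Require Import Defs.
From HB Require Import structures.
From Stdlib Require Import Reals Lra.
From mathcomp Require Import all_boot all_order all_algebra.
From mathcomp Require Import ring.
(* [all_boot] and [all_algebra] shadow [comp] and [skew]. *)
Import Defs.

Set Implicit Arguments.
Unset Strict Implicit.
Unset Printing Implicit Defensive.

Import GRing.Theory.
Local Open Scope ring_scope.

(** * Inertia matrices *)

(** Conversions to the operations that [lra] and [nra] recognise. *)
Lemma R_addE (x y : R) : x + y = Rplus x y. Proof. by []. Qed.
Lemma R_mulE (x y : R) : x * y = Rmult x y. Proof. by []. Qed.
Lemma R_oppE (x : R) : - x = Ropp x. Proof. by []. Qed.
Lemma R_zeroE : 0 = R0 :> R. Proof. by []. Qed.
Lemma R_oneE : 1 = R1 :> R. Proof. by []. Qed.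
Definition R_ringE := (R_addE, R_mulE, R_oppE, R_zeroE, R_oneE).

Lemma R_eqN0 (x : R) : x = - x -> x = 0.
Proof. rewrite !R_ringE; lra. Qed.

Lemma skew_linear (a : R) (x y : 'cV[R]_3) : skew (a *: x + y) = a *: skew x + skew y.
Proof.
apply/matrixP=> -[[|[|[|//]]] hi] [[|[|[|//]]] hj]; rewrite !mxE /comp /= ?mxE;
  ring.
Qed.

Lemma tr_skew (x : 'cV[R]_3) : (skew x)^T = - skew x.
Proof.
by apply/matrixP=> -[[|[|[|//]]] hi] [[|[|[|//]]] hj]; rewrite !mxE /= ?oppr0 ?opprK.
Qed.

Lemma hat_linear (a : R) (x y : 'cV[R]_10) : hat (a *: x + y) = a *: hat x + hat y.
Proof.
have e1 : pinertia (a *: x + y) = a *: pinertia x + pinertia y.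
  by apply/matrixP=> i j; rewrite !mxE /comp !mxE.
have e2 : pfirst (a *: x + y) = a *: pfirst x + pfirst y.
  by apply/matrixP=> i j; rewrite !mxE /comp !mxE.
have e3 : pmass (a *: x + y) = a * pmass x + pmass y.
  by rewrite /pmass /comp !mxE.
rewrite /hat (@scale_block_mx R 3 3 3 3) (@add_block_mx R 3 3 3 3).
rewrite e1 e2 e3 skew_linear [(_ + _)^T]linearP /=.
by rewrite raddfD /= -scale_scalar_mx.
Qed.

Lemma vee_linear (a : R) (M P : 'M[R]_6) : vee (a *: M + P) = a *: vee M + vee P.
Proof.
have e i j : ent (a *: M + P) i j = a * ent M i j + ent P i j.
  by rewrite /ent !mxE.
apply/matrixP=> i j; rewrite !mxE !e.
by case: i => -[|[|[|[|[|[|[|[|[|m]]]]]]]]] hm.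
Qed.

Lemma inord_lshift k : (k < 3)%N -> inord k = @lshift 3 3 (inord k) :> 'I_6.
Proof.
by move=> k3; apply: val_inj; rewrite /= !inordK // (leq_trans k3).
Qed.

Lemma inord_rshift k : (k < 3)%N -> inord (3 + k) = @rshift 3 3 (inord k) :> 'I_6.
Proof.
by move=> k3; apply: val_inj; rewrite /= !inordK // -[6%N]/(3 + 3)%N ltn_add2l.
Qed.

Lemma hatK : cancel hat vee.
Proof.
have l k := @inord_lshift k; have r k := @inord_rshift k.
move=> p; apply/matrixP=> i j; rewrite (ord1 j) mxE /ent.
have e : p i 0 = comp p (nat_of_ord i) by rewrite /comp inord_val.
rewrite e; case: i {e} => -[|[|[|[|[|[|[|[|[|[|//]]]]]]]]]] hi /=;
rewrite ?(r 0%N, r 1%N, r 2%N) ?(l 0%N, l 1%N, l 2%N) //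
  /hat ?(@block_mxEul R 3 3 3 3, @block_mxEur R 3 3 3 3, @block_mxEdr R 3 3 3 3) 
  !mxE /comp ?inordK //= ?mxE ?eqxx ?mulr1n ?inordK //.
Qed.

(** These three properties characterise the image of [hat]; both closure lemmas below reduce to
    checking them. *)
Lemma vee_hatK (M : 'M[R]_(3 + 3)) :
  M^T = M -> (ursubmx M)^T = - ursubmx M -> (exists c, drsubmx M = c%:M) ->
  hat (vee M) = M.
Proof.
have l k := @inord_lshift k; have r k := @inord_rshift k.
move=> sM skM [c dM].
have sE i j : M i j = M j i by rewrite -{1}sM mxE.
have inj3 k (k3 : (k < 3)%N) : Ordinal k3 = inord k by apply: val_inj; rewrite /= inordK.
have skE i j : M (lshift 3 i) (rshift 3 j) = - M (lshift 3 j) (rshift 3 i).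
  by move/matrixP/(_ j i): skM; rewrite !mxE.
have dE i j : M (rshift 3 i) (rshift 3 j) = c *+ (i == j).
  by move/matrixP/(_ i j): dM; rewrite !mxE.
have ur : skew (pfirst (vee M)) = ursubmx M.
  apply/matrixP=> -[[|[|[|//]]] hi] [[|[|[|//]]] hj]; rewrite !mxE /= /comp ?mxE /comp
   ?mxE ?inordK //= /ent ?inordK //= ?inj3
    ?(r 0%N, r 1%N, r 2%N) ?(l 0%N, l 1%N, l 2%N) // ?opprK //;
    first [by apply/esym/R_eqN0/skE | by rewrite [RHS]skE].
have ul : pinertia (vee M) = ulsubmx M.
  apply/matrixP=> -[[|[|[|//]]] hi] [[|[|[|//]]] hj]; rewrite !mxE /= /comp ?mxE /comp
   ?mxE ?inordK //= /ent ?inordK //= ?inj3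
    ?(r 0%N, r 1%N, r 2%N) ?(l 0%N, l 1%N, l 2%N) //; exact: sE.
have dl : (skew (pfirst (vee M)))^T = dlsubmx M.
  by rewrite ur -[in RHS]sM; apply/matrixP=> i j; rewrite !mxE.
have dr : (pmass (vee M))%:M = drsubmx M.
  rewrite dM; congr (_%:M).
  by rewrite /pmass /comp mxE inordK //= /ent (r 0%N) // dE eqxx.
by rewrite -[RHS]submxK /hat dl ul ur dr.
Qed.

Lemma tr_hat p : (hat p)^T = hat p.
Proof.
have sI : (pinertia p)^T = pinertia p.
  by apply/matrixP=> -[[|[|[|//]]] hi] [[|[|[|//]]] hj]; rewrite !mxE.
by rewrite /hat (@tr_block_mx R 3 3 3 3) trmxK sI tr_scalar_mx.
Qed.

(** With [Phi = [w; u]], the upper right block is [S(h) S(w) - S(w) S(h) - m S(u)], which is skew,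
    and the lower right block [m (S(w)^T + S(w))] is zero. *)
Lemma hat_cross6_closed (Phi : 'cV[R]_6) (p : 'cV[R]_10) :
  hat (vee ((cross6 Phi)^T *m hat p + hat p *m cross6 Phi)) =
  (cross6 Phi)^T *m hat p + hat p *m cross6 Phi.
Proof.
apply: vee_hatK.
  by rewrite linearD /= !trmx_mul tr_hat trmxK addrC.
all: rewrite /cross6 /hat (@tr_block_mx R 3 3 3 3) !(@mulmx_block R 3 3 3 3 3 3)
  (@add_block_mx R 3 3 3 3).
  rewrite block_mxKur !tr_skew mulmx0 add0r !mulNmx !(linearD, linearN) /=.
  rewrite !trmx_mul !tr_skew tr_scalar_mx !(mulNmx, mulmxN, opprK, opprD).
  by rewrite scalar_mxC addrC [in LHS](addrC (- _)) addrA.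
exists 0; rewrite block_mxKdr trmx0 mul0mx mulmx0 !add0r tr_skew scalar_mxC.
by rewrite mulmxN addNr raddf0.
Qed.

(** For [X] built from [R] and [x], the upper right block is [R^T S(h) R + m S(x)], again skew, and
    [R^T R = 1] keeps the lower right block equal to [m 1]. *)
Lemma hat_congr_closed (X : 'M[R]_6) (p : 'cV[R]_10) : spatial_transform X ->
  hat (vee (X^T *m hat p *m X)) = X^T *m hat p *m X.
Proof.
case=> Rm [x [[RR _] ->]]; apply: vee_hatK.
  by rewrite !trmx_mul trmxK tr_hat mulmxA.
all: rewrite /hat (@tr_block_mx R 3 3 3 3) !(@mulmx_block R 3 3 3 3 3 3).
  rewrite block_mxKur !mulmx0 !add0r [(- _)^T]linearN /= [(Rm *m _)^T]trmx_mul tr_skew.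
  rewrite [(- skew x) *m _]mulNmx opprK.
  rewrite mulmxDl -!mulmxA -(scalar_mxC _ Rm) [Rm^T *m (Rm *m _)]mulmxA RR mul1mx.
  by rewrite linearD /= !trmx_mul trmxK !tr_skew !tr_scalar_mx !(mulNmx, mulmxN) opprD -mulmxA scalar_mxC.
exists (pmass p); rewrite block_mxKdr trmx0 mul0mx mulmx0 !add0r.
by rewrite mul0mx add0r scalar_mxC -mulmxA RR mulmx1.
Qed.

(** * Derivatives and linear differential equations *)

Lemma dlim_const (c x : R) : derivable_pt_lim (fun=> c) x 0%R.
Proof. exact: derivable_pt_lim_const. Qed.

Lemma dlim_add f g x a b : derivable_pt_lim f x a -> derivable_pt_lim g x b ->
  derivable_pt_lim (fun t => f t + g t) x (a + b)%R.
Proof. exact: derivable_pt_lim_plus. Qed.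

Lemma dlim_mul f g x a b : derivable_pt_lim f x a -> derivable_pt_lim g x b ->
  derivable_pt_lim (fun t => f t * g t) x (a * g x + f x * b)%R.
Proof. exact: derivable_pt_lim_mult. Qed.

Lemma dlim_sum n (f : 'I_n -> R -> R) x (a : 'I_n -> R) :
  (forall i, derivable_pt_lim (f i) x (a i)) ->
  derivable_pt_lim (fun t => \sum_i f i t) x (\sum_i a i).
Proof.
elim: n f a => [|n IH] f a H.
  rewrite big_ord0; apply: (derivable_pt_lim_ext (fun=> 0)); last exact: dlim_const.
  by move=> t; rewrite big_ord0.
rewrite big_ord_recl; apply: derivable_pt_lim_ext; last first.
  by apply: dlim_add; [exact: (H ord0) | exact: (IH (fun i => f (lift ord0 i)))].
by move=> t; rewrite big_ord_recl.
Qed.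

(** Entrywise, as in [joint_model], so that the derivative hypothesis applies as it stands. *)
Definition mx_dlim m n (F : R -> 'M[R]_(m, n)) (x : R) (D : 'M[R]_(m, n)) :=
  forall i j, derivable_pt_lim (fun t => F t i j) x (D i j).

Lemma mx_dlim_mul m n p (F : R -> 'M[R]_(m, n)) (G : R -> 'M[R]_(n, p)) x D E :
  mx_dlim F x D -> mx_dlim G x E ->
  mx_dlim (fun t => F t *m G t) x (D *m G x + F x *m E).
Proof.
move=> HF HG i j; rewrite !mxE -big_split /=.
apply: (derivable_pt_lim_ext (fun t => \sum_k F t i k * G t k j)) => [t|].
  by rewrite mxE.
apply: (dlim_sum (f := fun k t => F t i k * G t k j)) => k.
exact: dlim_mul (HF _ _) (HG _ _).
Qed.

Lemma mx_dlim_tr m n (F : R -> 'M[R]_(m, n)) x D :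
  mx_dlim F x D -> mx_dlim (fun t => (F t)^T) x D^T.
Proof.
move=> HF i j; rewrite mxE; apply: derivable_pt_lim_ext; last exact: HF.
by move=> t; rewrite mxE.
Qed.

Lemma mx_dlim_const m n (A : 'M[R]_(m, n)) x : mx_dlim (fun=> A) x 0%R.
Proof. by move=> i j; rewrite mxE; apply: dlim_const. Qed.

Definition lie6 (Phi : 'cV[R]_6) (M : 'M[R]_6) : 'M[R]_6 :=
  (cross6 Phi)^T *m M + M *m cross6 Phi.

(** Product rule: each of the two outer factors contributes [- cross6 Phi], and the two terms
    together form [lie6]. *)
Lemma qform_dlim (Phi : 'cV[R]_6) (X : R -> 'M[R]_6) (M : 'M[R]_6) u q :
  mx_dlim X q (- (cross6 Phi *m X q)) ->
  derivable_pt_lim (fun t => qform M (X t *m u)) q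
    (- qform (lie6 Phi M) (X q *m u))%R.
Proof.
move=> HX.
have HXu := mx_dlim_mul HX (mx_dlim_const u q).
have := mx_dlim_mul (mx_dlim_mul (mx_dlim_tr HXu) (mx_dlim_const M q)) HXu.
move/(_ 0 0); congr derivable_pt_lim; rewrite /qform /lie6.
transitivity ((- ((X q *m u)^T *m ((cross6 Phi)^T *m M + M *m cross6 Phi)
                  *m (X q *m u))) 0 0); last by rewrite mxE.
congr (fun_of_matrix _ _ _).
rewrite !mulmx0 !addr0 !mulNmx [(- _)^T]linearN /= !trmx_mul mulmxDr mulmxDl.
by rewrite !(mulNmx, mulmxN) opprD !mulmxA.
Qed.

Lemma dlim0_const f : (forall t, derivable_pt_lim f t 0%R) -> forall x y, f x = f y.
Proof.
move=> Hf.
have lt x y : Rlt x y -> f x = f y.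
  by move=> xy; have [c [H _]] := MVT_cor2 f (fun=> R0) x y xy (fun c _ => Hf c); lra.
move=> x y; case: (Rtotal_order x y) => [|[->|]] // xy; first exact: lt.
by rewrite (lt y x).
Qed.

(** The bound makes [h t exp(-K t)] nonincreasing and [h t exp(K t)] nondecreasing, which settles
    [t > 0] and [t < 0] respectively. *)
Lemma gronwall0 (h h' : R -> R) (K : R) :
  (forall t, derivable_pt_lim h t (h' t)) ->
  (forall t, Rle (Rabs (h' t)) (Rmult K (h t))) -> (forall t, Rle R0 (h t)) ->
  h R0 = R0 -> forall t, h t = R0.
Proof.
move=> Hh Hb H0 h0 t.
have De c s : derivable_pt_lim (fun t => Rmult (h t) (exp (Rmult c t))) s
   (Rplus (Rmult (h' s) (exp (Rmult c s))) (Rmult (h s) (Rmult (exp (Rmult c s)) c))).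
  apply: (derivable_pt_lim_mult h (fun t => exp (Rmult c t))) => //.
  apply: (derivable_pt_lim_comp (fun t => Rmult c t) exp); last exact: derivable_pt_lim_exp.
  rewrite -[X in derivable_pt_lim _ _ X]Rmult_1_r.
  exact: (derivable_pt_lim_scal id c s R1 (derivable_pt_lim_id s)).
have Hb' s : Rle (h' s) (Rmult K (h s)) /\ Rle (Ropp (Rmult K (h s))) (h' s).
  have := Hb s; have := Rle_abs (h' s); have := Rle_abs (- h' s); rewrite Rabs_Ropp; lra.
have ep := exp_pos.
case: (Rtotal_order R0 t) => [|[<-|]] // ht.
- have [c [E _]] := MVT_cor2 _ _ R0 t ht (fun s _ => De (- K)%R s).
  have := Hb' c; have := H0 t; have := ep (Rmult (- K)%R c); have := ep (Rmult (- K)%R t).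
  move: E; rewrite h0 R_oppE.
  set e1 := exp (Rmult _ t); set e2 := exp (Rmult _ c) => E p1 p2 ht0 [hb1 hb2].
  (* This product of nonnegative factors is minus the right side of [E]; its sign makes the next
     bound linear. *)
  have k1 : Rle R0 (Rmult (Rmult (Rminus (Rmult K (h c)) (h' c)) e2) t).
    by do ?[apply: Rmult_le_pos]; lra.
  have : Rle (Rmult (h t) e1) R0 by lra.
  nra.
- have [c [E _]] := MVT_cor2 _ _ t R0 ht (fun s _ => De K s).
  have := Hb' c; have := H0 t; have := ep (Rmult K c); have := ep (Rmult K t).
  move: E; rewrite h0.
  set e1 := exp (Rmult _ t); set e2 := exp (Rmult _ c) => E p1 p2 ht0 [hb1 hb2].
  have k1 : Rle R0 (Rmult (Rmult (Rplus (h' c) (Rmult K (h c))) e2) (Ropp t)).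
    by do ?[apply: Rmult_le_pos]; lra.
  have : Rle (Rmult (h t) e1) R0 by lra.
  nra.
Qed.

Lemma sum_Rle n (f g : 'I_n -> R) : (forall i, Rle (f i) (g i)) ->
  Rle (\sum_i f i) (\sum_i g i).
Proof.
move=> H; apply: (big_ind2 Rle) => //; first exact: Rle_refl.
by move=> *; apply: Rplus_le_compat.
Qed.

Lemma Rabs_sum n (f : 'I_n -> R) : Rle (Rabs (\sum_i f i)) (\sum_i Rabs (f i)).
Proof.
apply: (big_ind2 (fun x y => Rle (Rabs x) y)) => [|x1 y1 x2 y2 H1 H2|i _].
- by rewrite Rabs_R0; apply: Rle_refl.
- by apply: Rle_trans (Rabs_triang _ _) _; apply: Rplus_le_compat.
- exact: Rle_refl.
Qed.

(** Gronwall for the sum of squares [h]: its derivative is a sum of terms [2 B_ij g_i g_j], and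
    [2 |g_i g_j| <= g_i^2 + g_j^2 <= 2 h]. *)
Lemma linear_ode_zero n (g : 'I_n -> R -> R) (B : 'I_n -> 'I_n -> R) :
  (forall i t, derivable_pt_lim (g i) t (\sum_j B i j * g j t)) ->
  (forall i, g i 0 = 0) -> forall i t, g i t = 0.
Proof.
move=> Hg g0 i t.
pose h t := \sum_i g i t * g i t.
have h_ge0 s : Rle R0 (h s).
  apply: (big_ind (fun x => Rle R0 x)) => [|x y|j _]; first exact: Rle_refl.
    exact: Rplus_le_le_0_compat.
  exact: Rle_0_sqr.
have le_h j s : Rle (g j s * g j s) (h s).
  rewrite /h (bigD1 j) //= -[X in Rle X _]Rplus_0_r.
  apply: Rplus_le_compat_l; apply: (big_ind (fun x => Rle R0 x)) => [|x y|k _].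
  - exact: Rle_refl.
  - exact: Rplus_le_le_0_compat.
  - exact: Rle_0_sqr.
have ht0 s : h s = R0.
  pose h' t := \sum_i \sum_j (B i j * (g j t * g i t) + g i t * (B i j * g j t)).
  apply: (@gronwall0 h h' (\sum_i \sum_j (Rabs (B i j) + Rabs (B i j)))) => //.
  - move=> r; apply: (dlim_sum (f := fun i t => g i t * g i t)) => j.
    rewrite big_split /=.
    under eq_bigr do rewrite mulrA.
    by rewrite -mulr_suml -mulr_sumr; apply: dlim_mul.
  - move=> r; apply: Rle_trans (Rabs_sum _) _.
    rewrite -R_mulE mulr_suml; apply: sum_Rle => j.
    apply: Rle_trans (Rabs_sum _) _.
    rewrite mulr_suml; apply: sum_Rle => k.
    have hj := le_h j r; have hk := le_h k r; have := Rabs_pos (B j k).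
    move: hj hk; rewrite !R_ringE => hj hk b0.
    have -> : Rplus (Rmult (B j k) (Rmult (g k r) (g j r)))
      (Rmult (g j r) (Rmult (B j k) (g k r))) =
      Rmult (B j k) (Rmult 2 (Rmult (g k r) (g j r))) by lra.
    rewrite Rabs_mult.
    have : Rle (Rabs (Rmult 2 (Rmult (g k r) (g j r)))) (Rplus (h r) (h r)).
      by apply: Rabs_le; nra.
    nra.
  - by rewrite /h big1 // => j _; rewrite -R_zeroE g0 mul0r.
by apply/Rsqr_0_uniq/Rle_antisym; [have := le_h i t; rewrite ht0 | exact: Rle_0_sqr].
Qed.

(** * Energy along one joint *)

HB.instance Definition _ :=
  GRing.isLinear.Build R 'cV[R]_10 'M[R]_6 _ hat hat_linear.
HB.instance Definition _ :=
  GRing.isLinear.Build R 'M[R]_6 'cV[R]_10 _ vee vee_linear.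

Lemma cV_sum_delta n (p : 'cV[R]_n) : p = \sum_j p j 0 *: delta_mx j 0.
Proof.
rewrite [LHS]matrix_sum_delta; apply: eq_bigr => i _; by rewrite big_ord1.
Qed.

Lemma qformD M P v : qform (M + P) v = qform M v + qform P v.
Proof. by rewrite /qform mulmxDr mulmxDl mxE. Qed.

Lemma qformZ (a : R) M v : qform (a *: M) v = a * qform M v.
Proof. by rewrite /qform -scalemxAr -scalemxAl mxE. Qed.

Lemma qformN M v : qform (- M) v = - qform M v.
Proof. by rewrite /qform mulmxN mulNmx mxE. Qed.

Lemma qform0 v : qform 0 v = 0.
Proof. by rewrite /qform mulmx0 mul0mx mxE. Qed.

Lemma qform_sum I (r : seq I) (P : pred I) (F : I -> 'M[R]_6) v :
  qform (\sum_(i <- r | P i) F i) v = \sum_(i <- r | P i) qform (F i) v.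
Proof.
exact: (big_morph (fun M => qform M v) (fun M P => qformD M P v) (qform0 v)).
Qed.

Lemma qform_congr (X M : 'M[R]_6) v : qform (X^T *m M *m X) v = qform M (X *m v).
Proof. by rewrite /qform trmx_mul !mulmxA. Qed.

Lemma qform_kvec p v : qform (hat p) v = ((kvec v)^T *m p) 0 0.
Proof.
rewrite {1}[p]cV_sum_delta linear_sum qform_sum !mxE.
by apply: eq_bigr => j _; rewrite linearZ qformZ !mxE mulrC.
Qed.

Lemma mx_pow_dep n (A : 'M[R]_n.+1) :
  exists c : 'I_n.+1 -> R, A ^+ n.+1 = \sum_i c i *: A ^+ i.
Proof.
have := Cayley_Hamilton A; rewrite -[char_poly A]coefK poly_def linear_sum /=.
rewrite size_char_poly big_ord_recr /=.
have := char_poly_monic A; rewrite monicE lead_coefE size_char_poly /= => /eqP ->.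
have hX i : horner_mx A 'X^i = A ^+ i by rewrite rmorphXn /= horner_mx_X.
rewrite scale1r hX => /eqP; rewrite addrC addr_eq0 => /eqP ->.
exists (fun i : 'I_n.+1 => - (char_poly A)`_i); rewrite -sumrN.
by apply: eq_bigr => i _; rewrite linearZ /= hX scaleNr.
Qed.

Lemma lie6_linear Phi : linear (lie6 Phi).
Proof.
by move=> a M P; rewrite /lie6 mulmxDr mulmxDl -scalemxAr -scalemxAl scalerDr addrACA.
Qed.

HB.instance Definition _ Phi :=
  GRing.isLinear.Build R 'M[R]_6 'M[R]_6 _ (lie6 Phi) (@lie6_linear Phi).

(** Column [j] holds the parameters of the image of the [j]-th basis vector. Acting on the ten
    parameters instead of all 6 by 6 matrices is what makes ten iterates enough. *)
Lemma lie6_hat_mx (Phi : 'cV[R]_6) :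
  exists A : 'M[R]_10, forall p, hat (A *m p) = lie6 Phi (hat p).
Proof.
exists (\matrix_(i, j) vee (lie6 Phi (hat (delta_mx j 0))) i 0) => p.
rewrite -[RHS]hat_cross6_closed -/(lie6 _ _); congr (hat _).
rewrite [in RHS](cV_sum_delta p) !linear_sum /=.
apply/colP=> i; rewrite summxE [LHS]mxE; apply: eq_bigr => j _.
rewrite [X in X * _]mxE [hat _ in RHS]linearZ /= [lie6 _ _ in RHS]linearZ /=.
by rewrite [vee _ in RHS]linearZ /= [RHS]mxE mulrC.
Qed.

(** The conditions on iterates start at [k = 1], so the Cayley-Hamilton relation for [A ^+ 10] is
    multiplied once more by [A] to avoid the iterate 0. *)
Lemma dI_iter_dep (Phi : 'cV[R]_6) p : exists c : 'I_10 -> R,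
  dI_iter Phi (hat p) 11 = \sum_i c i *: dI_iter Phi (hat p) i.+1.
Proof.
have [A hA] := lie6_hat_mx Phi; have [c hc] := mx_pow_dep A; exists c.
have itE k : dI_iter Phi (hat p) k = hat (A ^+ k *m p).
  elim: k => [|k IH]; first by rewrite expr0 mul1mx.
  by rewrite /dI_iter iterS -/(dI_iter _ _ _) IH -/(lie6 _ _) -hA mulmxA exprS.
rewrite itE exprS hc -mulmxE mulmx_sumr mulmx_suml linear_sum /=.
apply: eq_bigr => i _.
by rewrite -/(dI_iter _ _ _) itE -/(lie6 _ _) -hA mulmxA -scalemxAr -scalemxAl linearZ.
Qed.

Lemma dI_iterS Phi M k : dI_iter Phi M k.+1 = lie6 Phi (dI_iter Phi M k).
Proof. by []. Qed.

Lemma dI_iter_hat_closed Phi p k :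
  hat (vee (dI_iter Phi (hat p) k)) = dI_iter Phi (hat p) k.
Proof.
elim: k => [|k IH]; first by rewrite /dI_iter /= hatK.
by rewrite dI_iterS -IH hat_cross6_closed.
Qed.

Section OneJoint.

Variables (Phi : 'cV[R]_6) (X : R -> 'M[R]_6).
Hypothesis X_0 : X 0 = 1%:M.
Hypothesis dX : forall q, mx_dlim X q (- (cross6 Phi *m X q)).

(** Uniqueness of derivatives: each iterate gives, up to sign, the derivative of a function already
    known to be constant. *)
Lemma qform_iter_eq0 M u :
  (forall t, qform M (X t *m u) = qform M u) ->
  forall k t, qform (dI_iter Phi M k.+1) (X t *m u) = 0.
Proof.
move=> Hc; elim=> [|k IH] t.
  have := uniqueness_limite _ _ _ _ (qform_dlim M u (dX t)).
  move/(_ 0); rewrite dI_iterS /= => H; apply/eqP; rewrite -oppr_eq0; apply/eqP/H.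
  apply: (derivable_pt_lim_ext (fun=> qform M u)) => //; exact: dlim_const.
have := uniqueness_limite _ _ _ _ (qform_dlim (dI_iter Phi M k.+1) u (dX t)).
move/(_ 0); rewrite [dI_iter _ _ k.+2]dI_iterS => H.
apply/eqP; rewrite -oppr_eq0; apply/eqP/H.
by apply: (derivable_pt_lim_ext (fun=> 0)) => //; exact: dlim_const.
Qed.

(** The ten functions [g i] vanish at 0 and solve a closed linear system, so they vanish
    identically; the energy has derivative [- g ord0]. *)
Lemma qform_const p u :
  (forall k, (1 <= k <= 10)%N -> qform (dI_iter Phi (hat p) k) u = 0) ->
  forall t, qform (hat p) (X t *m u) = qform (hat p) u.
Proof.
move=> H t.
have [c hc] := dI_iter_dep Phi p.
pose g (i : 'I_10) t := qform (dI_iter Phi (hat p) i.+1) (X t *m u).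
have g0 i s : g i s = 0.
  (* A companion matrix up to sign: [g i] has derivative minus the next function, and in the last
     row [dI_iter_dep] expands the eleventh iterate. *)
  apply: (@linear_ode_zero _ g (fun i j => if i == ord_max then - c j
      else - (j == i.+1 :> nat)%:R)) => {s} [{}i s|{}i]; last first.
    by rewrite /g X_0 mul1mx H // ltn_ord.
  have := qform_dlim (dI_iter Phi (hat p) i.+1) u (dX s).
  congr derivable_pt_lim; rewrite -dI_iterS; case: eqP => [->|/eqP ni].
    rewrite hc qform_sum -sumrN.
    by apply: eq_bigr => j _; rewrite qformZ mulNr.
  have lti : (i.+1 < 10)%N.
    by rewrite ltn_neqAle ltn_ord andbT; apply: contra ni => /eqP [e]; apply/eqP/val_inj.
  rewrite (bigD1 (Ordinal lti)) //= eqxx mulN1r big1 ?addr0 // => j nj.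
  have -> : (j == i.+1 :> nat) = false by apply: contraNF nj => /eqP e; apply/eqP/val_inj.
  by rewrite oppr0 mul0r.
rewrite -[in RHS](mul1mx u) -X_0.
apply: (dlim0_const (f := fun t => qform (hat p) (X t *m u))) => s.
have := qform_dlim (hat p) u (dX s); congr derivable_pt_lim.
by apply/eqP; rewrite oppr_eq0; apply/eqP/(g0 ord0).
Qed.

End OneJoint.

(** * The transfer condition *)

(** The rows of [C] and the vectors of [S] span the same space, so they have the same annihilator.
    This removes the arbitrary choice of [V i] and [C i]. *)
Lemma range_span_orth n r (C : 'M[R]_(r, n)) (S : 'cV[R]_n -> Prop) :
  (forall x, in_range C^T x <-> in_span S x) ->
  forall w : 'cV[R]_n, C *m w = 0 <-> forall s, S s -> s^T *m w = 0.
Proof.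
move=> HC w; split=> [Cw0 s Ss|H].
  have /HC[y ->] : in_span S s.
    by exists 1%N, (fun=> 1), (fun=> s); rewrite big_ord1 scale1r.
  by rewrite trmx_mul trmxK -mulmxA Cw0 mulmx0.
apply/row_matrixP=> i; rewrite rowE row0 mulmxA.
have /HC[m [c [s [Ss e]]]] : in_range C^T (C^T *m (delta_mx 0 i)^T).
  by exists (delta_mx 0 i)^T.
rewrite -[_ *m C]trmxK trmx_mul e linear_sum mulmx_suml big1 // => k _.
by rewrite linearZ /= -scalemxAl H ?scaler0.
Qed.

Lemma mx11_eq0 (A : 'M[R]_1) : A 0 0 = 0 <-> A = 0.
Proof.
split=> [A0|->]; last by rewrite mxE.
by apply/matrixP=> i j; rewrite !ord1 A0 mxE.
Qed.

Lemma qform_shift (M : 'M[R]_6) (w z : 'cV[R]_6) (a : R) : M^T = M ->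
  qform M (w + a *: z) =
  qform M w + (a + a) * (w^T *m M *m z) 0 0 + a * a * qform M z.
Proof.
move=> sM.
have zw : (z^T *m M *m w) 0 0 = (w^T *m M *m z) 0 0.
  transitivity ((z^T *m M *m w)^T 0 0); first by rewrite [RHS]mxE.
  by rewrite !trmx_mul trmxK sM mulmxA.
rewrite /qform [(_ + _)^T]linearD /= [(_ *: _)^T]linearZ /= !mulmxDl !mulmxDr -!scalemxAl -!scalemxAr.
have aE (A B : 'M[R]_1) : (A + B) 0 0 = A 0 0 + B 0 0 by rewrite mxE.
have sE (b : R) (A : 'M[R]_1) : (b *: A) 0 0 = b * A 0 0 by rewrite mxE.
by rewrite !(aE, sE) zw; ring.
Qed.

(** Used to vary one joint alone: the bodies before it keep their velocities. *)
Definition upd (f : nat -> R) (i : nat) (x : R) (k : nat) : R :=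
  if k == i then x else f k.

Section Chain.

Variables (XJ : nat -> R -> 'M[R]_6) (XJc : nat -> 'M[R]_6) (Phi : nat -> 'cV[R]_6).

Local Notation vel := (vel XJ XJc Phi).

Lemma vel_upd q qd i j x a : (j < i)%N -> vel (upd q i x) (upd qd i a) j = vel q qd j.
Proof.
elim: j => [//|j IH] ji /=; rewrite IH; last exact: ltnW.
by rewrite /upd (ltn_eqF ji).
Qed.

Lemma vel_updS q qd j x a :
  vel (upd q j.+1 x) (upd qd j.+1 a) j.+1 =
  XJ j.+1 x *m (XJc j.+1 *m vel q qd j) + a *: Phi j.+1.
Proof. by rewrite /= vel_upd // /upd eqxx mulmxA. Qed.

(** The right-hand energy is the value at coordinate and rate 0 of joint [j.+1], so the equality
    says that the energy of body [j.+1] depends on neither. *)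
Lemma transfer_iff j p :
  XJ j.+1 0 = 1%:M ->
  (forall q, mx_dlim (XJ j.+1) q (- (cross6 (Phi j.+1) *m XJ j.+1 q))) ->
  (forall q qd, (vel q qd j.+1)^T *m (hat p *m Phi j.+1) = 0) /\
  (forall k, (1 <= k <= 10)%N -> forall q qd,
     qform (dI_iter (Phi j.+1) (hat p) k) (XJc j.+1 *m vel q qd j) = 0) <->
  forall q qd, qform (hat p) (vel q qd j.+1) = qform (hat p) (XJc j.+1 *m vel q qd j).
Proof.
move=> X0 dX; set M := hat p; set F := Phi j.+1.
have sM : M^T = M by exact: tr_hat.
split=> [[HV HC] q qd|H].
  have HV' x a : (XJ j.+1 x *m (XJc j.+1 *m vel q qd j) + a *: F)^T *m (M *m F) = 0.
    by rewrite -vel_updS HV.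
  (* Rate 0 gives orthogonality to the transported velocity; rate 1 then gives orthogonality to
     [F]. *)
  have w0 : (XJ j.+1 (q j.+1) *m (XJc j.+1 *m vel q qd j))^T *m (M *m F) = 0.
    by have := HV' (q j.+1) 0; rewrite scale0r addr0.
  have F0 : F^T *m (M *m F) = 0.
    by have := HV' (q j.+1) 1; rewrite scale1r [(_ + _)^T]linearD /= mulmxDl w0 add0r.
  rewrite /= -mulmxA qform_shift // -mulmxA w0 [qform M F]/qform -mulmxA F0 !mxE.
  by rewrite !mulr0 !addr0; apply: (qform_const X0 dX) => k hk; exact: HC.
have Hx q qd x a : qform M (XJ j.+1 x *m (XJc j.+1 *m vel q qd j) + a *: F) =
    qform M (XJc j.+1 *m vel q qd j).
  by rewrite -vel_updS H vel_upd.
split=> [q qd|k /andP[k1 _] q qd].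
  have h a := Hx q qd (q j.+1) a.
  rewrite /= -mulmxA.
  set w := XJ _ _ *m _ in h *.
  (* Subtracting the value at rate 0 leaves the linear and quadratic terms; the rates 1 and -1 then
     separate them. *)
  have {}h a : (a + a) * (w^T *m M *m F) 0 0 + a * a * qform M F = 0.
    by apply: (addrI (qform M w)); rewrite addrA -qform_shift // h -(h 0) scale0r !addr0.
  have [b0 c0] : (w^T *m M *m F) 0 0 = 0 /\ qform M F = 0.
    have := h 1; have := h (- 1); rewrite !R_ringE => h1 h2.
    by split; lra.
  rewrite [(_ + _)^T]linearD /= [(_ *: _)^T]linearZ /= mulmxDl -scalemxAl !mulmxA.
  by move/mx11_eq0: b0 ->; move/mx11_eq0: c0 ->; rewrite scaler0 addr0.
case: k k1 => // k _; set u := XJc _ *m _.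
have Hc t : qform M (XJ j.+1 t *m u) = qform M u.
  by have := Hx q qd t 0; rewrite scale0r addr0.
by have := qform_iter_eq0 dX Hc k 0; rewrite X0 mul1mx.
Qed.

End Chain.

(** * Decomposition of the nullspace *)

Section Decomposition.

Variables (XJ : nat -> R -> 'M[R]_6) (XJc : nat -> 'M[R]_6) (Phi : nat -> 'cV[R]_6).
Variables (wV : nat -> nat) (V : forall i, 'M[R]_(6, wV i)).
Variables (rC : nat -> nat) (C : forall i, 'M[R]_(rC i, 10)).

Local Notation vel := (vel XJ XJc Phi).

(** The range hypotheses depend on [N] explicitly so that the induction can restrict them to a
    shorter chain. *)
Definition rangeV N := forall i, (1 <= i <= N)%N ->
  forall x, in_range (V i) x <-> Vspace XJ XJc Phi i x.
Definition rangeC N := forall i, (i <= N)%N ->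
  forall x, in_range (C i)^T x <-> Kspace XJ XJc Phi i x.

(** A parameter vector is orthogonal to every [kvec v] exactly when the form of its [hat] vanishes
    at every such [v]; this turns the matrix conditions into those of [transfer_iff]. *)
Lemma Tspace_transfer_iff N j p :
  joint_model N XJ XJc Phi -> rangeV N -> rangeC N -> (j < N)%N ->
  (V j.+1)^T *m hat p *m Phi j.+1 = 0 /\
  (forall k, (1 <= k <= 10)%N -> C j *m
     vee ((XJc j.+1)^T *m dI_iter (Phi j.+1) (hat p) k *m XJc j.+1) = 0) <->
  forall q qd, qform (hat p) (vel q qd j.+1) =
    qform ((XJc j.+1)^T *m hat p *m XJc j.+1) (vel q qd j).
Proof.
move=> HJ HV HC jN; have [sX _ X0 dX] := HJ j.+1 jN.
have {}HV : forall x, in_range ((V j.+1)^T)^T x <-> Vspace XJ XJc Phi j.+1 x.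
  by rewrite trmxK; exact: HV.
have VE := range_span_orth HV (hat p *m Phi j.+1).
have CE k : C j *m vee ((XJc j.+1)^T *m dI_iter (Phi j.+1) (hat p) k *m XJc j.+1) = 0
    <-> forall q qd, qform (dI_iter (Phi j.+1) (hat p) k) (XJc j.+1 *m vel q qd j) = 0.
  rewrite (range_span_orth (HC j (ltnW jN))).
  have e q qd : qform (dI_iter (Phi j.+1) (hat p) k) (XJc j.+1 *m vel q qd j) =
    ((kvec (vel q qd j))^T *m
      vee ((XJc j.+1)^T *m dI_iter (Phi j.+1) (hat p) k *m XJc j.+1)) 0 0.
    rewrite -qform_kvec -dI_iter_hat_closed hat_congr_closed // dI_iter_hat_closed.
    by rewrite qform_congr.
  split=> [H q qd|H _ [q [qd ->]]].
    by rewrite e; apply/mx11_eq0/H; exists q, qd.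
  by apply/mx11_eq0; rewrite -e.
have T := transfer_iff XJc p X0 dX.
split=> [[HV0 HC0] q qd|H].
  rewrite qform_congr; apply: (iffLR T); split=> [{}q {}qd|k hk].
    by apply: (iffLR VE); [rewrite mulmxA | exists q, qd].
  exact/CE/HC0.
have [HV0 HC0] := iffRL T (fun q qd => etrans (H q qd) (qform_congr _ _ _)).
split=> [|k hk]; last exact/CE/HC0.
by rewrite -mulmxA; apply: (iffRL VE) => _ [q [qd ->]].
Qed.

(** Only bodies [i] and [i.-1] carry parameters, and the transfer condition makes their energies
    opposite. *)
Lemma Tspace_energy N i dp q qd :
  joint_model N XJ XJc Phi -> rangeV N -> rangeC N -> (1 <= i <= N)%N ->
  Tspace N XJc Phi V C i dp ->
  \sum_(1 <= j < N.+1) qform (hat (dp j)) (vel q qd j) = 0.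
Proof.
case: i => // i HJ HV HC iN [par tr V0 C0 supp].
have E : qform (hat (dp i.+1)) (vel q qd i.+1) =
    qform ((XJc i.+1)^T *m hat (dp i.+1) *m XJc i.+1) (vel q qd i).
  by apply: (iffLR (Tspace_transfer_iff (dp i.+1) HJ HV HC iN)).
have z j : j != i.+1 -> j != i -> qform (hat (dp j)) (vel q qd j) = 0.
  by move=> n1 n2; rewrite supp // linear0 qform0.
have v0 M : qform M 0 = 0 by rewrite /qform mulmx0 mxE.
(* Including body 0, which is at rest, gives joint 1 the same two-term form as the others. *)
transitivity (\sum_(0 <= j < N.+1) qform (hat (dp j)) (vel q qd j)).
  by rewrite [RHS]big_ltn // v0 add0r.
rewrite (big_cat_nat _ (n := i)) //=; last by rewrite ltnW // ltnS ltnW.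
rewrite big_nat big1 ?add0r; last first.
  by move=> j /andP[_ ji]; rewrite z ?(ltn_eqF ji) ?(ltn_eqF (leqW ji)).
rewrite big_ltn; last by rewrite ltnW // ltnS.
rewrite big_ltn ?ltnS // big_nat big1 ?addr0; last first.
  by move=> j /andP[ij _]; rewrite z ?(gtn_eqF ij) ?(gtn_eqF (ltnW ij)).
rewrite E; case: i tr {iN V0 C0 supp E z} => [|i] tr; first by rewrite !v0 addr0.
by rewrite (tr isT) qformN addNr.
Qed.

Lemma Tspace_widen N i dp : Tspace N XJc Phi V C i dp -> Tspace N.+1 XJc Phi V C i dp.
Proof.
case=> par *; split=> // j /orP[j0|jN]; apply: par; first by rewrite j0.
by rewrite ltnW ?orbT.
Qed.

Lemma nullspace_decomp N dp :
  joint_model N XJ XJc Phi -> rangeV N -> rangeC N -> nullspace N XJ XJc Phi dp ->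
  exists t : nat -> nat -> 'cV[R]_10,
    (forall i, (1 <= i <= N)%N -> Tspace N XJc Phi V C i (t i)) /\
    (forall j, dp j = \sum_(1 <= i < N.+1) t i j).
Proof.
elim: N dp => [|N IH] dp HJ HV HC [par en].
  exists (fun _ _ => 0); split=> [[|i] //|j].
  by rewrite big_geq // par // lt0n orbN.
have [sX _ X0 _] := HJ N.+1 (leqnn _).
have bS (F : nat -> R) :
    \sum_(1 <= j < N.+2) F j = \sum_(1 <= j < N.+1) F j + F N.+1.
  by rewrite big_nat_recr.
(* Resetting the last joint to coordinate and rate 0 leaves the other energies unchanged, so
   comparing two instances of the nullspace equation isolates the last body. *)
have E q qd : qform (hat (dp N.+1)) (vel q qd N.+1) =
    qform ((XJc N.+1)^T *m hat (dp N.+1) *m XJc N.+1) (vel q qd N).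
  have := en (upd q N.+1 0) (upd qd N.+1 0); have := en q qd.
  rewrite !bS vel_updS X0 mul1mx scale0r addr0.
  rewrite qform_congr.
  have -> : \sum_(1 <= j < N.+1) qform (hat (dp j)) (vel (upd q N.+1 0) (upd qd N.+1 0) j)
     = \sum_(1 <= j < N.+1) qform (hat (dp j)) (vel q qd j).
    by apply: eq_big_nat => j /andP[_ jN]; rewrite vel_upd.
  by set S := \sum_(_ <= _ < _) _ => e1 e2; apply: (@addrI _ S); rewrite e1 e2.
(* The last block of [dp] and the transfer condition force this choice; the guard [j != 0] keeps the
   ground free of parameters when [N = 0]. *)
pose tN j := if j == N.+1 then dp N.+1 else if (j == N) && (j != 0)%N
  then - vee ((XJc N.+1)^T *m hat (dp N.+1) *m XJc N.+1) else 0.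
have tNS : tN N.+1 = dp N.+1 by rewrite /tN eqxx.
have tNp j : (N.+1 < j)%N -> tN j = 0.
  by move=> jN; rewrite /tN (gtn_eqF jN) (gtn_eqF (ltnW jN)).
have T : Tspace N.+1 XJc Phi V C N.+1 tN.
  have [V0 C0] := iffRL (Tspace_transfer_iff (dp N.+1) HJ HV HC (leqnn _)) E.
  split; rewrite ?tNS //=.
  - by move=> j /orP[/eqP ->|/tNp //]; rewrite /tN andbF.
  - rewrite ltnS => N1; rewrite /tN (ltn_eqF (ltnSn N)) eqxx -lt0n N1 /=.
    by rewrite linearN /= hat_congr_closed.
  - by move=> j /negbTE j1 /negbTE j2; rewrite /tN j1 j2.
have HJ' : joint_model N XJ XJc Phi.
  by move=> i /andP[i1 iN]; apply: HJ; rewrite i1 ltnW.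
have HV' : rangeV N by move=> i /andP[i1 iN]; apply: HV; rewrite i1 ltnW.
have HC' : rangeC N by move=> i iN; apply: HC; rewrite ltnW.
(* Subtracting [tN] empties the last body at no cost in total energy, so the remainder belongs to
   the shorter chain. *)
have nul : nullspace N XJ XJc Phi (fun j => dp j - tN j).
  split=> [j /orP[/eqP ->|jN]|q qd].
  - by rewrite par // /tN andbF subr0.
  - case: (ltngtP j N.+1) jN => [|jN _|-> _] //.
      by rewrite tNp // par ?subr0 // jN orbT.
    by rewrite tNS subrr.
  have := Tspace_energy q qd HJ HV HC (leqnn N.+1 : (1 <= N.+1 <= N.+1)%N) T.
  have := en q qd; rewrite !bS tNS => e1 e2.
  transitivity (\sum_(1 <= j < N.+1) qform (hat (dp j)) (vel q qd j) -
                \sum_(1 <= j < N.+1) qform (hat (tN j)) (vel q qd j)).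
    by rewrite -sumrB; apply: eq_bigr => j _; rewrite linearB /= qformD qformN.
  by apply/eqP; rewrite subr_eq0; apply/eqP/(addIr (qform (hat (dp N.+1)) (vel q qd N.+1))); rewrite e1 e2.
have [t [Ht ts]] := IH _ HJ' HV' HC' nul.
exists (fun i => if i == N.+1 then tN else t i); split=> [i /andP[i1]|j].
  rewrite leq_eqVlt; case: eqP => [-> //|_ iN].
  by apply/Tspace_widen/Ht; rewrite i1.
rewrite big_nat_recr //= eqxx -[LHS](subrK (tN j)) ts; congr (_ + _).
by apply: eq_big_nat => i /andP[_ iN]; rewrite (ltn_eqF iN).
Qed.

(** An element of the [i]-th space has no block above [i] and is determined by block [i]. Going down
    from the last body, the sum at body [i] therefore reduces to [t i i]. *)
Lemma Tspace_independent N (t : nat -> nat -> 'cV[R]_10) :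
  (forall i, (1 <= i <= N)%N -> Tspace N XJc Phi V C i (t i)) ->
  (forall j, \sum_(1 <= i < N.+1) t i j = 0) ->
  forall i, (1 <= i <= N)%N -> forall j, t i j = 0.
Proof.
move=> HT Hs.
have supp i j : (1 <= i <= N)%N -> (i < j)%N -> t i j = 0.
  move=> hi ij; have [_ _ _ _] := HT i hi; apply.
    by rewrite gtn_eqF.
  by rewrite gtn_eqF // (leq_ltn_trans (leq_pred _)).
have zero_of_top i : (1 <= i <= N)%N -> t i i = 0 -> forall j, t i j = 0.
  move=> hi tii j; have [par tr _ _ su] := HT i hi.
  have [-> //|ji] := eqVneq j i; have [ej|jp] := eqVneq j i.-1; last exact: su.
  case: (posnP j) => [->|j0]; first by rewrite par.
  rewrite ej -[LHS]hatK tr; last by rewrite -ltn_predRL -ej.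
  by rewrite tii linear0 mulmx0 mul0mx oppr0 linear0.
(* Here [d] counts the top indices already known to give zero. *)
have H d : (d <= N)%N -> forall i, (N - d < i <= N)%N -> forall j, t i j = 0.
  elim: d => [|d IH] dN i; first by rewrite subn0 => /andP[/leq_trans h /h]; rewrite ltnn.
  move=> /andP[i1 i2]; have hi : (1 <= i <= N)%N by rewrite (leq_ltn_trans _ i1).
  case: (ltnP (N - d) i) => [i3|i3]; first by apply: IH => //; [exact: ltnW|rewrite i3].
  have := Hs i; rewrite (bigD1_seq i) ?mem_index_iota ?iota_uniq //= big1_seq ?addr0.
    exact: zero_of_top.
  move=> k /andP[ki]; rewrite mem_index_iota ltnS => hk.
  (* Summands with [k < i] do not reach body [i]; those with [k > i] vanish by induction. *)
  case: (ltngtP k i) ki => // ki _; first exact: supp.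
  apply: IH; first exact: ltnW.
  case/andP: hk => _ ->; rewrite andbT; apply: leq_ltn_trans ki.
  by move: i1; rewrite subnS; case: (N - d)%N.
by move=> i hi; apply: (H N) => //; rewrite subnn.
Qed.

End Decomposition.

Theorem theorem2
    (N : nat)
    (XJ : nat -> R -> 'M[R]_6) (XJc : nat -> 'M[R]_6) (Phi : nat -> 'cV[R]_6)
    (wV : nat -> nat) (V : forall i, 'M[R]_(6, wV i))
    (rC : nat -> nat) (C : forall i, 'M[R]_(rC i, 10)) :
  joint_model N XJ XJc Phi ->
  (forall i, (1 <= i <= N)%N ->
     forall x, in_range (V i) x <-> Vspace XJ XJc Phi i x) ->
  (forall i, (i <= N)%N ->
     forall x, in_range (C i)^T x <-> Kspace XJ XJc Phi i x) ->
  direct_sum N (nullspace N XJ XJc Phi) (Tspace N XJc Phi V C).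
Proof.
move=> HJ HV HC; split=> [dp|]; last exact: Tspace_independent.
split=> [|[t [Ht ts]]]; first exact: nullspace_decomp.
split=> [j hj|q qd].
  by rewrite ts big_nat big1 // => i hi; have [par _ _ _ _] := Ht i hi; rewrite par.
(* Energy is linear in the parameters, so the sums over bodies and over summands can be
   exchanged. *)
under eq_bigr do rewrite ts linear_sum qform_sum.
rewrite exchange_big big_nat big1 //= => i hi.
exact: (Tspace_energy q qd HJ HV HC hi (Ht i hi)).
Qed.
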